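(* Let $y_0\in ND(P(0))$ and $\Delta\in\Gamma_{y_0}$. Assume that there exists $x_1\in\Omega$ with $G(x_1)\cap(-\mathrm{int}(Z_+))\neq\emptyset$. Then $\Delta$ is a Lagrange multiplier of $(P(0))$ at $y_0$, i.e. $y_0\in \mathrm{cl}\big(\bigcup_{x\in\Omega}(F(x)+\Delta(G(x)+Z_+))\big)$ and $y_0$ is nondominated by the set $\bigcup_{x\in\Omega}(F(x)+\Delta(G(x)+Z_+))$. Furthermore, if $y_0$ is a minimal point of $(P(0))$, that is, if $y_0\in F(x_0)$ for some feasible $x_0\in S(0)$, then $y_0\in F(x_0)+\Delta(G(x_0)+Z_+)$ and $y_0\in\mathrm{Min}\big(\bigcup_{x\in\Omega}(F(x)+\Delta(G(x)+Z_+))\big)$ (i.e. $y_0$ is a minimal point of the program ''Min $F(x)+\Delta(G(x)+Z_+)$ such that $x\in\Omega$'', achieved at $x_0$), and $$\Delta(G(x_0)+Z_+)\cap(-Y_+)\subseteq(-Y_+)\cap Y_+ .$$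
   Context: Setting. $X,Y,Z$ are real normed spaces with topological duals $X^*,Y^*,Z^*$. $Y_+\subset Y$ and $Z_+\subset Z$ are convex cones (a cone is a nonempty set $K$ with $\alpha K\subset K$ for all real $\alpha\ge 0$) which are proper ($\{0\}\ne K$ and $K$ is not the whole space) and solid (nonempty interior). $Y_+$ preorders $Y$: $y_1\le y_2$ iff $y_2-y_1\in Y_+$; similarly for $Z_+$. $\Omega\subset X$ is a nonempty convex set, $F:\Omega\rightrightarrows Y$ and $G:\Omega\rightrightarrows Z$ are set-valued maps, $F$ is $Y_+$-convex (i.e. $\{(x,y): x\in\Omega,\ y\in F(x)+Y_+\}$ is convex) and $G$ is $Z_+$-convex. Sums of sets are Minkowski sums, with $A+\emptyset=\emptyset$. For a set-valued map $H$, $\mathrm{Graph}(H)=\{(u,v): v\in H(u)\}$, $\mathrm{Dom}(H)=\{u: H(u)\ne\emptyset\}$, $H(A)=\bigcup_{a\in A}H(a)$ for $A\subset\mathrm{Dom}(H)$. The parametric problem $(P(z))$, $z\in Z$, is: Min $F(x)$ such that $x\in\Omega$, $G(x)\cap(z-Z_+)\ne\emptyset$. Put $S(z)=\{x\in\Omega: G(x)\cap(z-Z_+)\neq\emptyset\}$ (assumed contained in $\mathrm{Dom}(F)$, so that the next image is defined), $V(z)=F(S(z))$, $(V+Y_+)(z)=V(z)+Y_+$. Elements of $S(0)$ are the feasible solutions of $(P(0))$. A point $y_0\in Y$ is nondominated by $A\subset Y$ if $A\cap(y_0-Y_+)\subset y_0+Y_+$; $\mathrm{Min}(A)$ is the set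 of points of $A$ nondominated by $A$. $ND(P(0))$ is the set of $y_0\in\mathrm{cl}(V(0))$ that are nondominated by $V(0)$. A minimal point of $(P(0))$ is an element of $\mathrm{Min}(V(0))$. A process is a set-valued map whose graph is a cone; it is convex/closed/pointed if its graph is convex/closed/pointed ($K\cap(-K)=\{0\}$). $P(Z,Y)$ is the set of closed convex processes $\Delta:Z\rightrightarrows Y$ with $\mathrm{Dom}(\Delta)=Z$. For $y_0\in ND(P(0))$, $\mathcal S_{Y_+}(y_0)$ is the set of $(z^*,y^* )\in Z^*\times Y^*$ with $\langle z^*,z'\rangle+\langle y^*,y'\rangle\le\langle y^*,y_0\rangle\le\langle z^*,z\rangle+\langle y^*,y\rangle$ for all $(z',y')\in(-Z_+)\times(y_0-Y_+)$ and all $(z,y)\in\mathrm{Graph}(V+Y_+)$; and $\mathcal S'_{Y_+}(y_0)=\mathcal S_{Y_+}(y_0)\setminus\{(0,0)\}$. For $(z^*,y^* )\ne(0,0)$, $S_{(z^*,y^* )}:Z\rightrightarrows Y$ is $S_{(z^*,y^* )}(z)=\{y\in Y:\langle z^*,z\rangle+\langle y^*,y\rangle\le0\}$, and $(-S_{(z^*,y^* )})(z)=-(S_{(z^*,y^* )}(z))$. Define $\Lambda_{(z^*,y^* )}=\{\Delta\in P(Z,Y): \mathrm{Graph}(\Delta)\setminus\{(0,0)\}\subseteq\mathrm{int}(\mathrm{Graph}(-S_{(z^*,y^* )}))\}$ and $\Gamma_{y_0}=\bigcup_{(z^*,y^* )\in\mathcal S'_{Y_+}(y_0)}\Lambda_{(z^*,y^*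 )}$. *)

(* Defs.v *)
From HB Require Import structures.
From mathcomp Require Import all_boot all_order all_algebra.
From mathcomp Require Import mathcomp_extra boolp classical_sets functions.
From mathcomp Require Import interval_inference reals topology normedtype convex.

Set Implicit Arguments.
Unset Strict Implicit.
Unset Printing Implicit Defensive.

Import Order.TTheory GRing.Theory Num.Theory.
Import numFieldNormedType.Exports.

Local Open Scope classical_set_scope.
Local Open Scope ring_scope.

Definition msum (V : zmodType) (A B : set V) : set V :=
  [set a + b | a in A & b in B].
Definition mopp (V : zmodType) (A : set V) : set V := [set - a | a in A].

Section SetValuedMaps.
Context {U V : Type}.
Implicit Types H : U -> set V.

Definition graph H : set (U * V) := [set p | H p.1 p.2].
Definition dom H : set U := [set u | H u !=set0].
Definition image_svm H (A : set U) : set V := \bigcup_(a in A) H a.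

End SetValuedMaps.

Section Cones.
Context {R : realType}.

Definition cone (V : lmodType R) (K : set V) : Prop :=
  K !=set0 /\ forall (a : R) (v : V), 0 <= a -> K v -> K (a *: v).

Definition proper_cone (V : lmodType R) (K : set V) : Prop :=
  K <> [set 0] /\ K <> setT.

Definition ordering_cone (V : normedModType R) (K : set V) : Prop :=
  [/\ cone K, convex_set K, proper_cone K & K° !=set0].

(* [H] stands for a set-valued map defined on [Omega] only; its values outside
   [Omega] are never used. *)
Definition cone_convex (U V : lmodType R) (Omega : set U) (K : set V)
    (H : U -> set V) : Prop :=
  convex_set [set p : U * V | Omega p.1 /\ msum (H p.1) K p.2].

Definition nondominated (V : zmodType) (K A : set V) (v : V) : Prop :=
  A `&` msum [set v] (mopp K) `<=` msum [set v] K.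

Definition Min_set (V : zmodType) (K A : set V) : set V :=
  [set v | A v /\ nondominated K A v].

Definition ND (V : normedModType R) (K A : set V) : set V :=
  [set v | closure A v /\ nondominated K A v].

End Cones.

Section Problem.
Context {R : realType} {X Y Z : normedModType R}.
Variables (Yp : set Y) (Zp : set Z) (Omega : set X).
Variables (F : X -> set Y) (G : X -> set Z).

Definition feasible (z : Z) : set X :=
  [set x | Omega x /\ G x `&` msum [set z] (mopp Zp) !=set0].

Definition value (z : Z) : set Y := image_svm F (feasible z).

Definition value_ext (z : Z) : set Y := msum (value z) Yp.

Definition lagrangian (Delta : Z -> set Y) (x : X) : set Y :=
  msum (F x) (image_svm Delta (msum (G x) Zp)).

Definition lagrangian_values (Delta : Z -> set Y) : set Y :=
  \bigcup_(x in Omega) lagrangian Delta x.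

Definition lagrange_multiplier (y0 : Y) (Delta : Z -> set Y) : Prop :=
  ND Yp (lagrangian_values Delta) y0.

Definition convex_closed_process : set (Z -> set Y) :=
  [set Delta | [/\ cone (graph Delta), convex_set (graph Delta),
                   closed (graph Delta) & dom Delta = setT]].

(* Topological duals are rendered as linear forms with an explicit continuity
   requirement. *)
Definition supports (y0 : Y) : set ({linear Z -> R^o} * {linear Y -> R^o}) :=
  [set p : {linear Z -> R^o} * {linear Y -> R^o} | [/\ continuous p.1, continuous p.2 &
    forall z' y' z y, mopp Zp z' -> msum [set y0] (mopp Yp) y' ->
      graph value_ext (z, y) ->
      p.1 z' + p.2 y' <= p.2 y0 <= p.1 z + p.2 y]].

Definition supports' (y0 : Y) : set ({linear Z -> R^o} * {linear Y -> R^o}) :=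
  [set p : {linear Z -> R^o} * {linear Y -> R^o} | supports y0 p /\
    ~ ((forall z, p.1 z = 0) /\ (forall y, p.2 y = 0))].

Definition half_space_map (p : {linear Z -> R^o} * {linear Y -> R^o}) (z : Z) :
  set Y := [set y | p.1 z + p.2 y <= 0].

Definition Lambda (p : {linear Z -> R^o} * {linear Y -> R^o}) :
    set (Z -> set Y) :=
  [set Delta | convex_closed_process Delta /\
    graph Delta `\ (0, 0) `<=` (graph (fun z => mopp (half_space_map p z)))°].

Definition Gamma (y0 : Y) : set (Z -> set Y) :=
  \bigcup_(p in supports' y0) Lambda p.

End Problem.

(* Main.v *)
Require Import Defs.
From HB Require Import structures.
From mathcomp Require Import all_boot all_order all_algebra.
From mathcomp Require Import mathcomp_extra boolp classical_sets functions.
From mathcomp Require Import interval_inference reals topology normedtype convex.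

Set Implicit Arguments.
Unset Strict Implicit.
Unset Printing Implicit Defensive.

Import Order.TTheory GRing.Theory Num.Theory.
Import numFieldNormedType.Exports.

Local Open Scope classical_set_scope.
Local Open Scope ring_scope.

(** Let [(zs, ys)] be the pair of forms supporting [y0] for which [Delta] lies in
    [Lambda], so that [graph Delta] minus the origin lies in the interior of
    [{(z, d) | zs z <= ys d}].  As [(zs, ys)] is nonzero, interior points of this
    half-space satisfy the strict inequality ([interior_half_space]), so every
    price [d] in [Delta z] has [zs z < ys d] unless [(z, d) = (0, 0)].

    A value of the Lagrangian map is [y = f + d] with [f] in [F x] and [d] in
    [Delta z] for some [z] in [G x + Zp].  Then [x] is feasible for [P(z)], and the
    support inequality [ys y0 <= zs z + ys f] combines with the price inequality
    into [ys y0 <= ys y], strictly unless [(z, d) = (0, 0)].  When [y <= y0],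
    positivity of [ys] on [Yp] gives [ys y <= ys y0], which forces
    [(z, d) = (0, 0)]: the value is then an ordinary one, attained at a feasible
    point of [P(0)], and nondomination by [V(0)] applies
    ([nondominated_lagrangian]).

    Conversely [0] belongs to [Delta 0], and to [G x + Zp] for feasible [x], so the
    Lagrangian values contain [V(0)] ([feasible_lagrangian]), and the closure
    condition is inherited from [V(0)].  The complementarity inclusion is
    nondomination applied to the points [y0 + d]. *)

(** Moving from an interior point a little in a direction where the form is
    positive stays in the half-space, which leaves room only for a negative value. *)
Lemma interior_half_space (R : realType) (V : normedModType R)
    (phi : {linear V -> R^o}) (a : V) :
  (exists v, phi v != 0) -> [set v | phi v <= 0]° a -> phi a < 0.
Proof.
move=> [v0 v0_neq0] a_int.
have [v v_gt0] : exists v, 0 < phi v.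
  by case: (ltrgtP (phi v0) 0) v0_neq0 => // h _;
    [exists (- v0); rewrite linearN oppr_gt0 | exists v0].
have cvg_line : a + t *: v @[t --> (0 : R)^'+] --> a.
  apply: cvg_at_right_filter; rewrite -[X in _ --> X]addr0 -(scale0r v).
  by apply: cvgD; [exact: cvg_cst | apply: cvgZr_tmp; exact: cvg_id].
have [t [t_gt0]] : exists t : R, 0 < t /\ phi (a + t *: v) <= 0.
  near (0 : R)^'+ => t; exists t; split; first by [].
  by near: t; exact: cvg_line a_int.
rewrite linearD linearZ /= => le0.
by apply: lt_le_trans le0; rewrite ltrDl mulr_gt0.
Unshelve. all: by end_near. Qed.

Lemma mem_msum_opp (V : zmodType) (K : set V) (u v : V) :
  msum [set u] (mopp K) v <-> K (u - v).
Proof.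
split=> [[_ -> [_ [k Kk <-] <-]]|Kuv]; first by rewrite opprB addrC subrK.
by exists u => //; exists (- (u - v)); [exists (u - v)|rewrite opprB addrC subrK].
Qed.

Lemma mem_msum_set1 (V : zmodType) (K : set V) (u v : V) :
  msum [set u] K v <-> K (v - u).
Proof.
split=> [[_ -> [k Kk <-]]|Kvu]; first by rewrite addrAC subrr add0r.
by exists u => //; exists (v - u) => //; rewrite addrC subrK.
Qed.

Lemma cone0 (R : realType) (V : lmodType R) (K : set V) : cone K -> K 0.
Proof. by case=> -[v Kv] /(_ 0 v (lexx _) Kv); rewrite scale0r. Qed.

Section Multiplier.
Context {R : realType} {X Y Z : normedModType R}.
Variables (Yp : set Y) (Zp : set Z) (Omega : set X).
Variables (F : X -> set Y) (G : X -> set Z).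
Hypotheses (cone_Yp : cone Yp) (cone_Zp : cone Zp).

Lemma feasibleP (z : Z) (x : X) :
  feasible Zp Omega G z x <-> Omega x /\ msum (G x) Zp z.
Proof.
split=> -[Ox].
  move=> [g [Gg /mem_msum_opp Kzg]]; split=> //.
  by exists g => //; exists (z - g) => //; rewrite addrC subrK.
move=> [g Gg [k Kk <-]]; split=> //; exists g; split=> //.
by apply/mem_msum_opp; rewrite addrAC subrr add0r.
Qed.

(** Take [z' = 0] and [y' = y0 - k] in the first support inequality.  Both
    inequalities are asserted together for each point of the graph, so the first
    one says something only when [V] has a value, here at [0]. *)
Lemma supports_ge0 (y0 : Y) p (k : Y) :
  value Zp Omega F G 0 !=set0 -> supports Yp Zp Omega F G y0 p ->
  Yp k -> 0 <= p.2 k.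
Proof.
move=> [y Vy] [_ _ supp] Yk.
have gr : graph (value_ext Yp Zp Omega F G) (0, y).
  by exists y => //; exists 0; [exact: cone0|rewrite addr0].
have z'0 : mopp Zp 0 by exists 0; [exact: cone0|rewrite oppr0].
have y'k : msum [set y0] (mopp Yp) (y0 - k).
  by apply/mem_msum_opp; rewrite opprB addrC subrK.
have /andP[+ _] := supp _ _ _ _ z'0 y'k gr.
by rewrite linear0 add0r linearB lerBlDr lerDl.
Qed.

Lemma supports_le (y0 : Y) p (x : X) (z : Z) (y : Y) :
  supports Yp Zp Omega F G y0 p -> feasible Zp Omega G z x -> F x y ->
  p.2 y0 <= p.1 z + p.2 y.
Proof.
move=> [_ _ supp] xz Fy.
have gr : graph (value_ext Yp Zp Omega F G) (z, y).
  by exists y; [exists x|exists 0; [exact: cone0|rewrite addr0]].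
have z'0 : mopp Zp 0 by exists 0; [exact: cone0|rewrite oppr0].
have y'0 : msum [set y0] (mopp Yp) y0.
  by apply/mem_msum_opp; rewrite subrr; exact: cone0.
by have /andP[] := supp _ _ _ _ z'0 y'0 gr.
Qed.

(** The graph of the process meets the boundary of the half-space only at the
    origin, and off the boundary the nonzero form [(z, d) |-> p.1 z - p.2 d] that
    cuts it out is negative. *)
Lemma Lambda_lt (p : {linear Z -> R^o} * {linear Y -> R^o})
    (Delta : Z -> set Y) (z : Z) (d : Y) :
  ~ ((forall z, p.1 z = 0) /\ (forall y, p.2 y = 0)) ->
  Lambda p Delta -> Delta z d -> (z, d) <> (0, 0) -> p.1 z < p.2 d.
Proof.
move=> p_neq0 [_ Delta_sub] Dzd zd_neq0.
pose phi : {linear (Z * Y)%type -> R^o} := (p.1 \o fst) \- (p.2 \o snd).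
have phi_neq0 : exists v, phi v != 0.
  apply: contrapT => phi0; apply: p_neq0.
  have {}phi0 v : phi v = 0.
    by apply/eqP; apply: contrapT => /negP nv; apply: phi0; exists v.
  split=> [u|u].
    by have := phi0 (u, 0); rewrite /phi /= linear0 subr0.
  by have := phi0 (0, u); rewrite /phi /= linear0 sub0r => /eqP;
    rewrite oppr_eq0 => /eqP.
rewrite -subr_lt0; apply: (interior_half_space (phi := phi) (a := (z, d))) => //.
apply: (@interiorS _ (graph (fun z => mopp (half_space_map p z)))).
  move=> [u _] [w /= + <-]; rewrite /half_space_map /= /phi /=.
  by rewrite linearN opprK.
by apply: Delta_sub.
Qed.

Lemma nondominated_lagrangian (y0 : Y) (Delta : Z -> set Y) :
  ND Yp (value Zp Omega F G 0) y0 -> Gamma Yp Zp Omega F G y0 Delta ->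
  nondominated Yp (lagrangian_values Zp Omega F G Delta) y0.
Proof.
move=> [y0_cl y0_nd] [p [supp p_neq0] Lp].
have V0 : value Zp Omega F G 0 !=set0.
  by have [y [Vy _]] := y0_cl setT filterT; exists y.
move=> _ [[x Ox [f Ff [d [z Gz Dzd] <-]]] fd_le].
have xz : feasible Zp Omega G z x by apply/feasibleP.
have y0_le := supports_le supp xz Ff.
have fd_le_y0 : p.2 f + p.2 d <= p.2 y0.
  by rewrite -subr_ge0 -linearD -linearB;
    apply: supports_ge0 V0 supp _; apply/mem_msum_opp.
have [[z0 d0]|zd_neq0] := pselect ((z, d) = (0, 0)).
  move: xz fd_le; rewrite {}z0 {}d0 addr0 => xz f_le.
  by apply: y0_nd; split=> //; exists x.
have zd_lt := Lambda_lt p_neq0 Lp Dzd zd_neq0.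
have := le_trans fd_le_y0 y0_le.
by rewrite addrC lerD2r leNgt zd_lt.
Qed.

Lemma feasible_lagrangian (Delta : Z -> set Y) (x : X) (y : Y) :
  Delta 0 0 -> feasible Zp Omega G 0 x -> F x y -> lagrangian Zp F G Delta x y.
Proof.
move=> D0 /feasibleP[_ G0] Fy.
by exists y => //; exists 0; [exists 0|rewrite addr0].
Qed.

End Multiplier.

Theorem theorem3p9 (R : realType) (X Y Z : normedModType R)
    (Yp : set Y) (Zp : set Z) (Omega : set X)
    (F : X -> set Y) (G : X -> set Z)
    (hYp : ordering_cone Yp) (hZp : ordering_cone Zp)
    (hOmega0 : Omega !=set0) (hOmega : convex_set Omega)
    (hF : cone_convex Omega Yp F) (hG : cone_convex Omega Zp G)
    (hdom : forall z : Z, feasible Zp Omega G z `<=` dom F)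
    (y0 : Y) (hy0 : ND Yp (value Zp Omega F G 0) y0)
    (Delta : Z -> set Y) (hDelta : Gamma Yp Zp Omega F G y0 Delta)
    (slater : exists x1 : X, Omega x1 /\ G x1 `&` mopp (Zp°) !=set0) :
  lagrange_multiplier Yp Zp Omega F G y0 Delta /\
  (Min_set Yp (value Zp Omega F G 0) y0 <->
     exists x0 : X, feasible Zp Omega G 0 x0 /\ F x0 y0) /\
  (forall x0 : X, feasible Zp Omega G 0 x0 -> F x0 y0 ->
     [/\ lagrangian Zp F G Delta x0 y0,
         Min_set Yp (lagrangian_values Zp Omega F G Delta) y0 &
         image_svm Delta (msum (G x0) Zp) `&` mopp Yp `<=` mopp Yp `&` Yp]).
Proof.
have [cone_Yp _ _ _] := hYp; have [cone_Zp _ _ _] := hZp.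
have [y0_cl y0_nd] := hy0.
have Delta0 : Delta 0 0.
  by have [p _ [[cone_D _ _ _] _]] := hDelta; exact: (cone0 cone_D).
have nd := nondominated_lagrangian cone_Yp cone_Zp hy0 hDelta.
split; last split.
- split=> //; apply: closureS y0_cl => y [x xS Fy].
  by exists x; [case: xS|exact: feasible_lagrangian xS Fy].
- by split=> [[[x0 xS Fy] _]|[x0 [xS Fy]]]; [exists x0|split=> //; exists x0].
move=> x0 xS Fy; have Ox0 : Omega x0 by case: xS.
have Ly0 := feasible_lagrangian Delta0 xS Fy.
split=> //; first by split=> //; exists x0.
move=> d [Dd Yd]; split=> //.
have /mem_msum_set1 : msum [set y0] Yp (y0 + d).
  apply: nd; split; first by exists x0 => //; exists y0 => //; exists d.
  by exists y0 => //; exists d.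
by rewrite addrAC subrr add0r.
Qed.
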